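(* The full subcategory $\mathrm{QCB}_0(\mathbf{P})$ of $\mathrm{QCB}_0$ whose objects are the spaces in $\bigcup_{n}\mathrm{QCB}_0(\mathbf{\Sigma}^1_n)$ and whose morphisms are all continuous functions between them is cartesian closed (it is closed under the binary products and exponentials formed in $\mathrm{QCB}_0$).
   Context: $\mathrm{QCB}_0$ is the cartesian closed category of $T_0$-spaces that are topological quotients of countably based spaces, with continuous maps; binary products carry the sequentialization of the product topology and exponentials $Y^X$ consist of the continuous maps with the sequentialization of the compact-open topology. Let $\mathcal{N}=\omega^\omega$ be the Baire space. For a space $X$: $\mathbf{\Pi}^0_2(X)$ = complements of countable unions of sets $U\setminus V$ with $U,V$ open; $\mathbf{\Sigma}^1_1(X)=\{pr_X(A)\mid A\in\mathbf{\Pi}^0_2(\mathcal{N}\times X)\}$, $\mathbf{\Sigma}^1_{n+1}(X)=\{pr_X(A)\mid A\in\mathbf{\Pi}^1_n(\mathcal{N}\times X)\}$ with $pr_X(A)=\{x\mid\exists p\in\mathcal{N}\,(p,x)\in A\}$; $\mathbf{\Pi}^1_n(X)$ = complements of $\mathbf{\Sigma}^1_n(X)$-sets; $\mathbf{\Delta}^1_n=\mathbf{\Sigma}^1_n\cap\mathbf{\Pi}^1_n$, and $\mathbf{\Sigma}^1_0=\mathbf{\Pi}^1_0=\mathbf{\Delta}^1_1$. A representation of $X$ is a surjection $\delta$ from $\mathrm{dom}(\delta)\subseteq\mathcal{N}$ onto $X$; it is admissible if continuous and every continuous $\nu:Z\to X$ from a zero-dimensional countably based $T_0$-space $Z$ factors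 as $\nu=\delta g$ with $g:Z\to\mathrm{dom}(\delta)$ continuous. $\mathit{EQ}(\delta)=\{(p,q)\mid p,q\in\mathrm{dom}(\delta),\delta(p)=\delta(q)\}$. $\mathrm{QCB}_0(\Gamma)$ is the class of spaces having an admissible representation $\delta$ with $\mathit{EQ}(\delta)\in\Gamma(\mathcal{N}\times\mathcal{N})$. *)

(* Defs.v *)
From HB Require Import structures.
From mathcomp Require Import all_boot all_classical.
From mathcomp Require Import topology.

Set Implicit Arguments.
Unset Strict Implicit.
Unset Printing Implicit Defensive.

Local Open Scope classical_set_scope.

Definition seq_open {X : topologicalType} (U : set X) : Prop :=
  forall (u : nat -> X) (x : X),
    U x -> u @ \oo --> x -> \forall n \near \oo, U (u n).

(* The carrier is the one of [X]; only the topology changes. *)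
Definition sequentialization (X : topologicalType) : Type := X.

Section sequentialization.
Variable X : topologicalType.

Local Lemma seq_openT : seq_open [set: X].
Proof. by move=> u x _ _; apply: nearW. Qed.

Local Lemma seq_openI : setI_closed (@seq_open X).
Proof.
by move=> A B oA oB u x [Ax Bx] ux; apply: filterI; [apply: oA ux|apply: oB ux].
Qed.

Local Lemma seq_open_bigU (I : Type) (f : I -> set X) :
  (forall i, seq_open (f i)) -> seq_open (\bigcup_i f i).
Proof.
move=> fo u x [i _ fix_] ux.
by apply: filterS (fo i u x fix_ ux) => n fiu; exists i.
Qed.

HB.instance Definition _ := Choice.on (sequentialization X).
HB.instance Definition _ := isOpenTopological.Build (sequentialization X)
  seq_openT seq_openI seq_open_bigU.

Lemma open_sequentialization (U : set X) :
  (open : set_system (sequentialization X)) U = seq_open U.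
Proof. by []. Qed.

Lemma open_seq_open (U : set X) : open U -> seq_open U.
Proof. by move=> oU u x Ux; apply; apply: open_nbhs_nbhs. Qed.

Lemma sequentialization_cts : continuous (id : sequentialization X -> X).
Proof. by apply/continuousP => U /open_seq_open. Qed.

End sequentialization.

Definition seqprod (X Y : topologicalType) : topologicalType :=
  sequentialization (X * Y)%type.

Definition compact_open_space (X Y : topologicalType) : topologicalType :=
  initial_topology
    (fun f : continuousType X Y => (f : X -> Y) : {compact-open, X -> Y}).

(* [seqexp X Y] is the exponential Y^X. *)
Definition seqexp (X Y : topologicalType) : topologicalType :=
  sequentialization (compact_open_space X Y).

Section structure_maps.
Variables X Y : topologicalType.

Lemma seqfst_cts : continuous (fst : seqprod X Y -> X).
Proof.
move=> z; apply: continuous_comp; first exact: sequentialization_cts.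
exact: cvg_fst.
Qed.

Lemma seqsnd_cts : continuous (snd : seqprod X Y -> Y).
Proof.
move=> z; apply: continuous_comp; first exact: sequentialization_cts.
exact: cvg_snd.
Qed.

Definition seqfst : continuousType (seqprod X Y) X := mkcts seqfst_cts.
Definition seqsnd : continuousType (seqprod X Y) Y := mkcts seqsnd_cts.

End structure_maps.

Lemma compact_cvg_tail (X : topologicalType) (u : nat -> X) (x : X) (N : nat) :
  u @ \oo --> x -> compact (x |` [set u n | n in [set n | N <= n]%N]).
Proof.
move=> ux; apply/compact_near_coveringP => I F P FF nP.
have [[V W] /= [Vx FW] VWP] := nP x (or_introl erefl).
have [M _ uM] := ux _ Vx.
pose K := [set u n | n in `I_M] `&` [set u n | n in [set n | N <= n]%N].
have /compact_near_coveringP cK : compact K.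
  by apply: finite_compact; apply: finite_setIl; exact/finite_image/finite_II.
have FK : \forall i \near F, K `<=` P i.
  by apply: cK => y [_ yN]; apply: nP; right.
near=> i => _ [->|[n /= Nn <-]].
  by apply: (VWP (x, i)); split=> /=; [exact: nbhs_singleton|near: i].
have [Mn|nM] := leqP M n.
  by apply: (VWP (u n, i)); split=> /=; [exact: uM|near: i].
by apply: (near FK i) => //; split; exists n.
Unshelve. all: by end_near. Qed.

Lemma seqeval_cts (X Y : topologicalType) :
  continuous (eval : seqprod (seqexp X Y) X -> Y).
Proof.
apply/continuousP => O oO; rewrite [open _]open_sequentialization.
move=> u [f x] Ofx ufx.
pose toco (g : seqexp X Y) : {compact-open, X -> Y} := g : X -> Y.
have toco_cts : continuous toco.
  move=> g A gA.
  have := @sequentialization_cts (compact_open_space X Y) g (toco @^-1` A).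
  apply; exact: (@initial_continuous _ _
    (fun h : continuousType X Y => (h : X -> Y) : {compact-open, X -> Y}) g A gA).
have uf : (toco \o (fst \o u)) @ \oo --> toco f.
  have uf1 : (fst \o u) @ \oo --> f by apply: cvg_comp ufx _; exact: cvg_fst.
  exact: cvg_comp uf1 (toco_cts f).
have ux : (snd \o u) @ \oo --> x.
  by apply: cvg_comp ufx _; exact: cvg_snd.
have oV : open ((f : X -> Y) @^-1` O).
  by move/continuousP : (@cts_fun _ _ f); exact.
have [N _ uN] := ux _ (open_nbhs_nbhs (conj oV Ofx)).
have cK := compact_cvg_tail (N := N) ux.
have /compact_open_cvgP/(_ _ _ cK oO) := uf.
case; first by move=> _ [y [->|[n /= Nn <-]] <-] //; exact: (uN n).
move=> M _ fM; exists (maxn N M) => // n /=; rewrite geq_max => /andP[Nn Mn].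
apply: (fM n Mn); exists (u n).2; first by right; exists n.
by rewrite /eval /uncurry /toco /=; case: (u n).
Qed.

Definition seqeval (X Y : topologicalType) :
  continuousType (seqprod (seqexp X Y) X) Y := mkcts (@seqeval_cts X Y).

Record category := Category {
  ob :> Type;
  hom : ob -> ob -> Type;
  idmap : forall a, hom a a;
  compose : forall a b c, hom b c -> hom a b -> hom a c;
  compose1m : forall a b (f : hom a b), compose (idmap b) f = f;
  composem1 : forall a b (f : hom a b), compose f (idmap a) = f;
  composeA : forall a b c d (h : hom c d) (g : hom b c) (f : hom a b),
    compose h (compose g f) = compose (compose h g) f
}.

Arguments hom {_} _ _.
Arguments idmap {_} _.
Arguments compose {_ _ _ _} _ _.

Section cartesian_closed.
Variable C : category.

Definition is_terminal (t : C) : Prop :=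
  forall a : C, exists! f : hom a t, True.

Definition is_product (a b p : C) (p1 : hom p a) (p2 : hom p b) : Prop :=
  forall (c : C) (f : hom c a) (g : hom c b),
    exists! h : hom c p, compose p1 h = f /\ compose p2 h = g.

(* [ea] is a product of [e] and [a], and [k] below is the map h x id_a. *)
Definition is_exponential (a b e ea : C)
    (p1 : hom ea e) (p2 : hom ea a) (ev : hom ea b) : Prop :=
  is_product p1 p2 /\
  forall (c ca : C) (q1 : hom ca c) (q2 : hom ca a), is_product q1 q2 ->
    forall f : hom ca b, exists! h : hom c e,
      exists k : hom ca ea,
        [/\ compose p1 k = compose h q1, compose p2 k = q2 & compose ev k = f].

Definition cartesian_closed : Prop :=
  [/\ exists t : C, is_terminal t,
      forall a b : C, exists (p : C) (p1 : hom p a) (p2 : hom p b),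
        is_product p1 p2
    & forall a b : C, exists (e ea : C)
        (p1 : hom ea e) (p2 : hom ea a) (ev : hom ea b),
        is_exponential p1 p2 ev].

End cartesian_closed.

Section Top.
Implicit Types X Y Z W : topologicalType.

Definition ctsid X : continuousType X X := idfun.
Definition ctscomp X Y Z (g : continuousType Y Z) (f : continuousType X Y) :
  continuousType X Z := g \o f.

Lemma ctscomp1m X Y (f : continuousType X Y) : ctscomp (ctsid Y) f = f.
Proof. exact/continuousEP. Qed.

Lemma ctscompm1 X Y (f : continuousType X Y) : ctscomp f (ctsid X) = f.
Proof. exact/continuousEP. Qed.

Lemma ctscompA X Y Z W (h : continuousType Z W) (g : continuousType Y Z)
    (f : continuousType X Y) :
  ctscomp h (ctscomp g f) = ctscomp (ctscomp h g) f.
Proof. exact/continuousEP. Qed.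

Definition Top : category := Category ctscomp1m ctscompm1 ctscompA.

End Top.

Definition full_subcategory (C : category) (P : C -> Prop) : category :=
  @Category {a : C | P a} (fun a b => hom (sval a) (sval b))
    (fun a => idmap (sval a)) (fun a b c g f => compose g f)
    (fun a b f => compose1m f) (fun a b f => composem1 f)
    (fun a b c d h g f => composeA h g f).

Definition quotient_map (Z X : topologicalType) (q : Z -> X) : Prop :=
  set_surj [set: Z] [set: X] q /\
  forall U : set X, open U <-> open (q @^-1` U).

Definition is_QCB0 (X : topologicalType) : Prop :=
  @kolmogorov_space X /\
  exists Z : topologicalType, @second_countable Z /\
    exists q : Z -> X, quotient_map q.

Definition baire_space : topologicalType :=
  prod_topology (fun _ : nat => nat : topologicalType).

Definition pointclass : Type := forall X : topologicalType, set (set X).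

Definition Pi02 : pointclass := fun X =>
  [set A | exists U V : nat -> set X,
    [/\ forall n, open (U n), forall n, open (V n)
      & A = ~` \bigcup_n (U n `\` V n)]].

Definition pr (X : topologicalType) (A : set (seqprod baire_space X)) : set X :=
  [set x | exists p : baire_space, A (p, x)].

(* [Sigma1S n] is the pointclass of index n.+1. *)
Fixpoint Sigma1S (n : nat) : pointclass := fun X =>
  match n with
  | 0 => [set pr A | A in @Pi02 (seqprod baire_space X)]
  | m.+1 => [set pr A | A in [set A | Sigma1S m (~` A)]]
  end.

Definition Sigma1 (n : nat) : pointclass := fun X =>
  match n with
  | 0 => [set A | Sigma1S 0 A /\ Sigma1S 0 (~` A)]
  | m.+1 => @Sigma1S m X
  end.

(* The library's [zero_dimensional] only asks that clopen sets separate
   points, which is weaker than having a base of clopen sets. *)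
Definition clopen_based (Z : topologicalType) : Prop :=
  exists2 B : set (set Z), basis B & B `<=` clopen.

Section representations.
Variables (X : topologicalType) (D : set baire_space) (delta : D -> X).

Definition representation : Prop := set_surj [set: D] [set: X] delta.

Definition admissible : Prop :=
  continuous delta /\
  forall Z : topologicalType,
    clopen_based Z -> @second_countable Z -> @kolmogorov_space Z ->
    forall nu : Z -> X, continuous nu ->
      exists g : Z -> D, continuous g /\ nu = delta \o g.

Definition EQ : set (seqprod baire_space baire_space) :=
  [set pq | exists p q : D,
    delta p = delta q /\ pq = (set_val p, set_val q)].

End representations.

Definition QCB0_class (Gamma : pointclass) (X : topologicalType) : Prop :=
  is_QCB0 X /\
  exists (D : set baire_space) (delta : D -> X),
    [/\ representation delta, admissible delta & Gamma _ (EQ delta)].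

Definition is_QCB0P (X : topologicalType) : Prop :=
  exists n : nat, QCB0_class (Sigma1 n) X.

Definition QCB0P : category := @full_subcategory Top is_QCB0P.

Definition mkQCB0P (X : topologicalType) (hX : is_QCB0P X) : QCB0P :=
  exist _ X hX.

Definition space (X : QCB0P) : topologicalType := sval X.

(* Main.v *)
(** Everything rests on sequences: a QCB0-space [X] is sequential, and every
    convergent sequence of [X] lifts along an admissible representation, which
    is therefore a quotient map.

    Continuous maps [X -> Y] are represented by those [p] in Baire space that
    code a partial continuous function on Baire space inducing a map
    [X -> Y] through the given representations [dX] and [dY].  Admissibility is
    obtained by lifting [Z * dom dX -> Y] along [dY] and coding the lift by a
    continuous map from [Z] to Baire space.  Two codes [p, p'] are equivalent iff
    for all [(q, q')] in [EQ dX] there are [r, r'], the values of [p] at [q] and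
    of [p'] at [q'], with [(r, r')] in [EQ dY].  "The value of [p] at [q] is [r]"
    is a Pi^0_2 relation, so this is a projective condition as soon as [EQ dX] and
    [EQ dY] are projective: projective sets are closed under intersection,
    complement, continuous preimages and projections. *)

Require Import Defs.
From mathcomp Require Import all_boot all_classical.
From mathcomp Require Import topology.

Set Implicit Arguments.
Unset Strict Implicit.
Unset Printing Implicit Defensive.

Local Open Scope classical_set_scope.

(** * Sequential spaces and sequentialization *)

Definition sequential (X : topologicalType) : Prop :=
  forall U : set X, seq_open U -> open U.

(** A set open in the sequentialization absorbs convergent sequences by definition, so refining the
    topology loses none of them. *)
Lemma cvg_sequentialization (X : topologicalType) (u : nat -> X) (x : X) :
  u @ \oo --> x -> u @ \oo --> (x : sequentialization X).
Proof.
move=> ux A; rewrite nbhsE => -[U [oU Ux] UA].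
by apply: (filterS UA); exact: oU Ux ux.
Qed.

Lemma sequential_sequentialization (X : topologicalType) :
  sequential (sequentialization X).
Proof.
move=> U sU; rewrite [open _]open_sequentialization => u x Ux ux.
by apply: (sU u x Ux); exact: (@cvg_sequentialization X).
Qed.

Lemma sequential_continuous (X Y : topologicalType) (f : X -> Y) :
  sequential X ->
  (forall (u : nat -> X) (x : X), u @ \oo --> x -> f \o u @ \oo --> f x) ->
  continuous f.
Proof.
move=> sX fP; apply/continuousP => U oU; apply: sX => u x Ufx ux.
exact: (fP u x ux) (open_nbhs_nbhs (conj oU Ufx)).
Qed.

Lemma cvg_cts (X Y : topologicalType) (f : X -> Y) (u : nat -> X) (x : X) :
  continuous f -> u @ \oo --> x -> f \o u @ \oo --> f x.
Proof. by move=> cf ux; apply: cvg_comp ux _; exact: cf. Qed.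

Lemma cvg_seqprod (X Y : topologicalType) (u : nat -> seqprod X Y)
    (z : seqprod X Y) :
  fst \o u @ \oo --> z.1 -> snd \o u @ \oo --> z.2 -> u @ \oo --> z.
Proof.
move=> u1 u2; apply: (@cvg_sequentialization (X * Y)%type).
have -> : u = fun n => ((fst \o u) n, (snd \o u) n).
  by apply/funext => n /=; rewrite -surjective_pairing.
by case: z u1 u2 => x y; exact: cvg_pair.
Qed.

Lemma pair_seqprod_cts (Z X Y : topologicalType) (f : Z -> X) (g : Z -> Y) :
  sequential Z -> continuous f -> continuous g ->
  continuous ((fun z => (f z, g z)) : Z -> seqprod X Y).
Proof.
move=> sZ cf cg; apply: sequential_continuous => // u x ux.
by apply: cvg_seqprod; [exact: cvg_cts cf ux|exact: cvg_cts cg ux].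
Qed.

(** * Countable bases and clopen bases *)

(** The index type is left free: cylinders are indexed by finite sequences and product bases by
    pairs, and are enumerated by [nat] only afterwards. *)
Definition base_seq (Z : topologicalType) (I : Type) (B : I -> set Z) : Prop :=
  (forall i, open (B i)) /\
  forall z A, nbhs z A -> exists i, B i z /\ B i `<=` A.

Lemma second_countable_base_seq (Z : topologicalType) :
  @second_countable Z -> exists B : nat -> set Z, base_seq B.
Proof.
move=> [B cB [oB bB]].
have /countable_injP[f finj] := cB.
(* The union over a fibre of the injection [f] has at most one member, and is empty outside the
   range of [f]. *)
exists (fun n => \bigcup_(U in [set U | B U /\ f U = n]) U); split.
  by move=> n; apply: bigcup_open => U [/oB].
move=> z A /bB[U /= [BU Uz] UA]; exists (f U); split; first by exists U.
by move=> y [V [BV fVU] Vy]; apply: UA; rewrite -(finj V U) ?inE.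
Qed.

(** If [U] is not a neighbourhood of [z], points outside [U] can be chosen in smaller and smaller
    neighbourhoods of [z]; they converge to [z], against sequential openness. *)
Lemma base_seq_sequential (Z : topologicalType) (B : nat -> set Z) :
  base_seq B -> sequential Z.
Proof.
move=> [oB bB] U sU; rewrite openE => z Uz; rewrite /interior.
apply: contrapT => nU.
(* [V n] is the intersection of those among the first [n.+1] basic sets that contain [z]. *)
pose V n := [set y | forall i, (i <= n)%N -> B i z -> B i y].
have nV n : nbhs z (V n).
  elim: n => [|n IH].
    have [Bz|nBz] := pselect (B 0%N z).
      apply: filterS (open_nbhs_nbhs (conj (oB 0%N) Bz)) => y By i.
      by rewrite leqn0 => /eqP ->.
    by apply: nearW => y i; rewrite leqn0 => /eqP ->.
  have [Bz|nBz] := pselect (B n.+1 z).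
    apply: filterS (filterI IH (open_nbhs_nbhs (conj (oB n.+1) Bz))).
    move=> y [Vy By] i; rewrite leq_eqVlt => /orP[/eqP ->//|]; exact: Vy.
  apply: filterS IH => y Vy i; rewrite leq_eqVlt => /orP[/eqP ->//|]; exact: Vy.
have /choice[u uP] n : exists y, V n y /\ ~ U y.
  apply: contrapT => nex; apply: nU; apply: filterS (nV n) => y Vy.
  by apply: contrapT => nUy; apply: nex; exists y.
have uz : u @ \oo --> z.
  move=> A /bB[i [Biz BA]]; exists i => // n /= iu; apply: BA.
  by have [+ _] := uP n; apply.
have [N _ /(_ N (leqnn N))] := sU u z Uz uz.
by case: (uP N).
Qed.

Lemma second_countable_sequential (Z : topologicalType) :
  @second_countable Z -> sequential Z.
Proof. by case/second_countable_base_seq => B /base_seq_sequential. Qed.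

Lemma quotient_sequential (Z X : topologicalType) (q : Z -> X) :
  sequential Z -> quotient_map q -> sequential X.
Proof.
move=> sZ [_ qP] U sU; apply/qP; apply: sZ => u z Uz uz.
apply: (sU (q \o u) (q z)) => //.
apply: cvg_cts => //; apply/continuousP => V; exact: (proj1 (qP V)).
Qed.

Lemma QCB0_sequential (X : topologicalType) : is_QCB0 X -> sequential X.
Proof.
move=> [_ [Z [/second_countable_sequential sZ [q qP]]]].
exact: quotient_sequential sZ qP.
Qed.

(* Zero-dimensional and countably based, with the two properties witnessed by
   a single enumerated base. *)
Definition clopen_base (Z : topologicalType) (I : Type) (C : I -> set Z) :=
  (forall i, closed (C i)) /\ base_seq C.

Lemma clopen_base_enum (Z : topologicalType) (I : countType) (C : I -> set Z) :
  clopen_base C -> exists C' : nat -> set Z, clopen_base C'.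
Proof.
move=> [cC [oC bC]].
exists (fun n => if unpickle n is Some i then C i else set0); split; [|split].
- by move=> n; case: unpickle => [i|]; [exact: cC|exact: closed0].
- by move=> n; case: unpickle => [i|]; [exact: oC|exact: open0].
by move=> z A /bC[i iP]; exists (pickle i); rewrite pickleK.
Qed.

(** The given base of clopen sets may be uncountable, so one clopen set is chosen between [B i] and
    [B j] for each pair that admits one; the default [set0] is clopen as well. *)
Lemma clopen_base_exists (Z : topologicalType) :
  clopen_based Z -> @second_countable Z ->
  exists C : nat -> set Z, clopen_base C.
Proof.
move=> [K [_ bK] clK] /second_countable_base_seq[B [oB bB]].
pose P ij := [set A : set Z | clopen A /\ B ij.1 `<=` A /\ A `<=` B ij.2].
pose C (ij : nat * nat) := xget set0 (P ij).
have clC ij : clopen (C ij).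
  by rewrite /C; case: xgetP => [A _ []//|_]; exact: clopen0.
suff /clopen_base_enum : clopen_base C by [].
split; [|split] => [ij|ij|z A]; [by case: (clC ij)..|].
move=> /bB[j [Bjz BjA]].
have [V /= [KV Vz] VBj] := bK z _ (open_nbhs_nbhs (conj (oB j) Bjz)).
have [i [Biz BiV]] := bB z V (open_nbhs_nbhs (conj (proj1 (clK _ KV)) Vz)).
have : P (i, j) (C (i, j)) by apply: xgetPex; exists V; split; [exact: clK|].
move=> [_ /= [BiC CBj]]; exists (i, j); split; first exact: BiC.
exact: subset_trans CBj BjA.
Qed.

Lemma clopen_base_clopen_based (Z : topologicalType) (C : nat -> set Z) :
  clopen_base C -> clopen_based Z.
Proof.
move=> [cC [oC bC]]; exists (range C); last by move=> _ [i _ <-].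
split; first by move=> _ [i _ <-].
by move=> z A /bC[i [Ciz CA]]; exists (C i) => //; split=> //; exists i.
Qed.

Lemma base_seq_second_countable (Z : topologicalType) (C : nat -> set Z) :
  base_seq C -> @second_countable Z.
Proof.
move=> [oC bC]; exists (range C); first exact: card_image_le.
split; first by move=> _ [i _ <-].
by move=> z A /bC[i [Ciz CA]]; exists (C i) => //; split=> //; exists i.
Qed.

Lemma initial_clopen_base (S : choiceType) (Z : topologicalType) (f : S -> Z)
    (I : Type) (C : I -> set Z) :
  clopen_base C ->
  clopen_base (fun i => (f @^-1` (C i) : set (initial_topology f))).
Proof.
move=> [cC [oC bC]]; have cf := @initial_continuous _ _ f.
split; [|split].
- by move=> i; move/continuous_closedP : cf; exact.
- by move=> i; move/continuousP : cf; exact.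
move=> z A [_ [[U oU <-] Uz UA]].
have [i [Ciz CU]] := bC _ _ (open_nbhs_nbhs (conj oU Uz)).
by exists i; split=> // y /CU; exact: UA.
Qed.

Lemma prod_clopen_base (Y Z : topologicalType) (I J : Type)
    (C : I -> set Y) (D : J -> set Z) :
  clopen_base C -> clopen_base D ->
  clopen_base (fun ij : I * J => C ij.1 `*` D ij.2).
Proof.
move=> [cC [oC bC]] [cD [oD bD]].
have c1 : continuous (fst : Y * Z -> Y) by move=> x; exact: cvg_fst.
have c2 : continuous (snd : Y * Z -> Z) by move=> x; exact: cvg_snd.
split; [|split].
- move=> [i j]; apply: closedI.
    by move/continuous_closedP : c1; exact.
  by move/continuous_closedP : c2; exact.
- move=> [i j]; apply: openI.
    by move/continuousP : c1; exact.
  by move/continuousP : c2; exact.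
move=> [y z] A [[U V] /= [/bC[i [iy iU]] /bD[j [jz jV]] UVA]].
exists (i, j); split=> // -[y' z'] [/= yi zj].
by apply: UVA; split=> /=; [exact: iU|exact: jV].
Qed.

(** * The topology of Baire space *)

(** The sets that contain all points sharing some prefix with [p] form a filter, which converges to
    [p] because it does so in each coordinate. Conversely, a prefix condition is a finite
    intersection of open conditions. *)
Lemma nbhs_baire (p : baire_space) (A : set baire_space) :
  nbhs p A <->
  exists m, forall q : baire_space, (forall i, (i < m)%N -> q i = p i) -> A q.
Proof.
split.
  pose F := [set A : set baire_space | exists m,
    forall q : baire_space, (forall i, (i < m)%N -> q i = p i) -> A q].
  have FF : Filter F.
    split.
    - by exists 0%N.
    - move=> B C [m mB] [n nC]; exists (maxn m n) => q qp; split.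
        by apply: mB => i im; apply: qp; rewrite leq_max im.
      by apply: nC => i im; apply: qp; rewrite leq_max im orbT.
    - by move=> B C BC [m mB]; exists m => q /mB; exact: BC.
  suff : (F : set_system baire_space) --> p by apply.
  apply/cvg_sup => k B [_ [[U oU <-] Up UB]].
  by exists k.+1 => q qp; apply: UB; rewrite /preimage/= /proj qp.
move=> [m mA].
have : nbhs p [set q : baire_space | forall i, (i < m)%N -> q i = p i].
  elim: m {mA} => [|m IH]; first by apply: filterS filterT => q _ i.
  have : nbhs p [set q : baire_space | q m = p m].
    have := @proj_continuous nat (fun=> nat : topologicalType) m p [set p m].
    by apply; exact: discrete_set1.
  move=> nm; apply: filterS (filterI IH nm) => q [qi qm] i.
  by rewrite ltnS leq_eqVlt => /orP[/eqP ->//|]; exact: qi.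
by apply: filterS => q; exact: mA.
Qed.

Lemma cvg_baire (u : nat -> baire_space) (p : baire_space) :
  u @ \oo --> p <-> forall k, \forall n \near \oo, u n k = p k.
Proof.
split=> [up k|up A /nbhs_baire[m mA]].
  apply: (up [set q : baire_space | q k = p k]).
  by apply/nbhs_baire; exists k.+1 => q; exact.
suff : \forall n \near \oo, forall i, (i < m)%N -> u n i = p i.
  by apply: filterS => n; exact: mA.
elim: m {mA} => [|m IH]; first by apply: nearW => ? ?.
apply: filterS (filterI IH (up m)) => n [ui um] i.
by rewrite ltnS leq_eqVlt => /orP[/eqP ->//|]; exact: ui.
Qed.

Definition cylinder (s : seq nat) : set baire_space :=
  [set q | forall i, (i < size s)%N -> q i = nth 0%N s i].

Lemma baire_clopen_base : clopen_base cylinder.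
Proof.
split; [|split].
- move=> s p clp i si.
  have [|q [qs qp]] := clp [set q | q i = p i].
    by apply/nbhs_baire; exists i.+1 => q; exact.
  by rewrite -qp qs.
- move=> s; rewrite openE => p ps; apply/nbhs_baire; exists (size s) => q qp i si.
  by rewrite qp // ps.
move=> p A /nbhs_baire[m mA]; exists (mkseq p m).
split=> [i|q]; rewrite /cylinder/= size_mkseq.
  by move=> im; rewrite nth_mkseq.
by move=> qp; apply: mA => i im; rewrite qp // nth_mkseq.
Qed.

Lemma baire_subset_clopen_base (D : set baire_space) :
  clopen_base (fun s => set_val @^-1` cylinder s : set D).
Proof. exact: initial_clopen_base baire_clopen_base. Qed.

Lemma baire_kolmogorov : kolmogorov_space baire_space.
Proof.
move=> p q pq; have [k pk] : exists k, p k != q k.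
  apply: contrapT => npq; move/eqP : pq; apply; apply/funext => k.
  by apply: contrapT => /eqP pqk; apply: npq; exists k.
exists [set r : baire_space | r k = p k]; left; split.
  by rewrite inE; apply/nbhs_baire; exists k.+1 => r; exact.
by rewrite inE /= => qk; rewrite qk eqxx in pk.
Qed.

(** * Projective sets *)

Lemma continuous_compose (X Y Z : topologicalType) (f : X -> Y) (g : Y -> Z) :
  continuous f -> continuous g -> continuous (g \o f).
Proof. by move=> cf cg x; apply: continuous_comp; [exact: cf|exact: cg]. Qed.

Lemma sequential_seqprod (X Y : topologicalType) : sequential (seqprod X Y).
Proof. exact: sequential_sequentialization. Qed.

Lemma sequential_baire : sequential baire_space.
Proof.
have [C [_ bC]] := clopen_base_enum baire_clopen_base.
exact: base_seq_sequential bC.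
Qed.

Definition evens (p : baire_space) : baire_space := fun n => p n.*2.
Definition odds (p : baire_space) : baire_space := fun n => p n.*2.+1.
(** Merging two points into one turns two existential quantifiers over Baire space into a single
    one. *)
Definition interleave (p q : baire_space) : baire_space :=
  fun n => if odd n then q n./2 else p n./2.

Lemma evens_interleave p q : evens (interleave p q) = p.
Proof. by apply/funext => n; rewrite /evens /interleave odd_double doubleK. Qed.

Lemma odds_interleave p q : odds (interleave p q) = q.
Proof.
by apply/funext => n; rewrite /odds /interleave /= odd_double uphalf_double.
Qed.

Lemma evens_cts : continuous evens.
Proof.
apply: sequential_continuous sequential_baire _ => u p /cvg_baire up.
by apply/cvg_baire => k; exact: up.
Qed.

Lemma odds_cts : continuous odds.
Proof.
apply: sequential_continuous sequential_baire _ => u p /cvg_baire up.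
by apply/cvg_baire => k; exact: up.
Qed.

Lemma interleave_cts (Z : topologicalType) (f g : Z -> baire_space) :
  sequential Z -> continuous f -> continuous g ->
  continuous (fun z => interleave (f z) (g z)).
Proof.
move=> sZ cf cg; apply: sequential_continuous => // u z uz.
have /cvg_baire fz := cvg_cts cf uz; have /cvg_baire gz := cvg_cts cg uz.
by apply/cvg_baire => k; rewrite /interleave /=; case: (odd k); [exact: gz|exact: fz].
Qed.

(** Numbers that decode to no index contribute an empty difference. *)
Lemma Pi02_countable (X : topologicalType) (I : countType) (U V : I -> set X) :
  (forall i, open (U i)) -> (forall i, open (V i)) ->
  Pi02 (~` \bigcup_i (U i `\` V i)).
Proof.
move=> oU oV; pose W (T : I -> set X) n :=
  if unpickle n is Some i then T i else set0.
have oW T : (forall i, open (T i)) -> forall n, open (W T n).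
  by move=> oT n; rewrite /W; case: unpickle => [i|]; [exact: oT|exact: open0].
exists (W U), (W V); split; [exact: oW|exact: oW|congr (~` _)].
apply/seteqP; split=> x [i _].
  by move=> Ui; exists (pickle i); rewrite // /W pickleK.
by rewrite /W; case: unpickle => [j|] [] // Uj nVj; exists j.
Qed.

Lemma Pi02_preimage (X Y : topologicalType) (f : X -> Y) (A : set Y) :
  continuous f -> Pi02 A -> Pi02 (f @^-1` A).
Proof.
move=> /continuousP cf [U [V [oU oV ->]]].
exists (fun n => f @^-1` (U n)), (fun n => f @^-1` (V n)).
by split=> [n|n|]; [exact: cf|exact: cf|rewrite preimage_setC].
Qed.

Lemma Pi02I (X : topologicalType) (A B : set X) :
  Pi02 A -> Pi02 B -> Pi02 (A `&` B).
Proof.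
move=> [U [V [oU oV ->]]] [U' [V' [oU' oV' ->]]].
pose W (S T : nat -> set X) (i : nat + nat) :=
  match i with inl n => S n | inr n => T n end.
rewrite (_ : _ `&` _ = ~` \bigcup_i (W U U' i `\` W V V' i)).
  by apply: Pi02_countable => -[n|n] /=.
rewrite -setCU; congr (~` _); apply/seteqP; split=> x.
  by move=> [[n _]|[n _]] Un; [exists (inl n)|exists (inr n)].
by move=> [[n|n] _ Un]; [left|right]; exists n.
Qed.

(** The intersection of two differences of open sets is again one: subtract the union of the two
    subtracted sets. *)
Lemma Pi02U (X : topologicalType) (A B : set X) :
  Pi02 A -> Pi02 B -> Pi02 (A `|` B).
Proof.
move=> [U [V [oU oV ->]]] [U' [V' [oU' oV' ->]]].
rewrite -setCI (_ : \bigcup_n _ `&` _ = \bigcup_(i : nat * nat)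
  ((U i.1 `&` U' i.2) `\` (V i.1 `|` V' i.2))).
  by apply: Pi02_countable => -[m n] /=; [exact: openI|exact: openU].
apply/seteqP; split=> x.
  by move=> [[m _ [Um Vm]] [n _ [Un Vn]]]; exists (m, n) => //; split=> // -[].
move=> [[m n] _ /= [[Um Un] /not_orP[Vm Vn]]].
by split; [exists m|exists n].
Qed.

Lemma open_Pi02 (X : topologicalType) (A : set X) : open A -> Pi02 A.
Proof.
move=> oA; exists (fun=> setT), (fun=> A); split=> // [_|]; first exact: openT.
by rewrite bigcup_const ?setTD ?setCK//; exists 0%N.
Qed.

Lemma Pi02_bigcap (X : topologicalType) (O : nat -> set X) :
  (forall n, open (O n)) -> Pi02 (\bigcap_n O n).
Proof.
move=> oO; exists (fun=> setT), O; split=> // [_|]; first exact: openT.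
by rewrite setC_bigcup; apply: eq_bigcapr => n _; rewrite setTD setCK.
Qed.

(** The index is aligned with [Sigma1S]: [PiS n] holds the sets whose projections make up
    [Sigma1S n], so its level 0 is Pi^0_2 and level [n.+1] is Pi^1 of index [n.+1]. *)
Definition PiS (n : nat) : pointclass := fun X =>
  match n with
  | 0 => @Pi02 X
  | m.+1 => [set A | Sigma1S m (~` A)]
  end.

Lemma Sigma1SE n X : @Sigma1S n X = [set pr A | A in @PiS n (seqprod baire_space X)].
Proof. by case: n. Qed.

(** Projection commutes with preimage along id x f, and preimage commutes with complement, which
    carries the induction through. *)
Lemma Sigma1S_preimage n (X Y : topologicalType) (f : X -> Y) (A : set Y) :
  continuous f -> Sigma1S n A -> Sigma1S n (f @^-1` A).
Proof.
elim: n X Y f A => [|n IH] X Y f A cf; rewrite !Sigma1SE => -[B PB <-].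
  exists ((fun w : seqprod baire_space X => (w.1, f w.2)) @^-1` B) => //.
  apply: Pi02_preimage PB; apply: pair_seqprod_cts.
  - exact: sequential_seqprod.
  - exact: seqfst_cts.
  - exact: continuous_compose (@seqsnd_cts _ _) cf.
exists ((fun w : seqprod baire_space X => (w.1, f w.2)) @^-1` B) => //.
apply: (IH _ _ _ _ _ PB); apply: pair_seqprod_cts.
- exact: sequential_seqprod.
- exact: seqfst_cts.
- exact: continuous_compose (@seqsnd_cts _ _) cf.
Qed.

Lemma PiS_preimage n (X Y : topologicalType) (f : X -> Y) (A : set Y) :
  continuous f -> PiS n A -> PiS n (f @^-1` A).
Proof. by case: n => [|n] cf; [exact: Pi02_preimage|exact: Sigma1S_preimage]. Qed.

(** The set is the projection of its cylinder over a dummy coordinate. *)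
Lemma PiS_Sigma1S n (X : topologicalType) (A : set X) : PiS n A -> Sigma1S n A.
Proof.
move=> PA; rewrite Sigma1SE; exists (snd @^-1` A).
  exact: PiS_preimage (@seqsnd_cts _ _) PA.
apply/seteqP; split=> x; first by case.
by move=> Ax; exists (fun=> 0%N).
Qed.

Lemma Sigma1SC n (X : topologicalType) (A : set X) :
  Sigma1S n A -> Sigma1S n.+1 (~` A).
Proof. by move=> SA; apply: PiS_Sigma1S; rewrite /= setCK. Qed.

(** One witness replaces two: its even entries serve the inner projection and its odd entries the
    outer one. *)
Lemma Sigma1S_pr n (X : topologicalType) (A : set (seqprod baire_space X)) :
  Sigma1S n A -> Sigma1S n (pr A).
Proof.
rewrite !Sigma1SE => -[B PB <-].
exists ((fun w : seqprod baire_space X =>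
  (evens w.1, (odds w.1, w.2)) : seqprod _ (seqprod _ _)) @^-1` B).
  apply: PiS_preimage PB.
  have cf := @seqfst_cts baire_space X; have sq := @sequential_seqprod.
  apply: pair_seqprod_cts => //; first exact: continuous_compose cf evens_cts.
  apply: pair_seqprod_cts => //; first exact: continuous_compose cf odds_cts.
  exact: seqsnd_cts.
apply/seteqP; split=> x [p] => [Bp|[q Bqp]]; first by exists (odds p), (evens p).
by exists (interleave q p); rewrite /preimage/= evens_interleave odds_interleave.
Qed.

(** A union can share the witness, while an intersection needs the two witnesses interleaved. *)
Lemma Sigma1SIU_of_PiS n :
  (forall (Y : topologicalType) (C D : set Y),
    PiS n C -> PiS n D -> PiS n (C `&` D) /\ PiS n (C `|` D)) ->
  forall (X : topologicalType) (A B : set X),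
    Sigma1S n A -> Sigma1S n B -> Sigma1S n (A `&` B) /\ Sigma1S n (A `|` B).
Proof.
move=> PIU X A B; rewrite !Sigma1SE => -[C PC <-] [D PD <-]; split; last first.
  exists (C `|` D); first by have [] := PIU _ _ _ PC PD.
  apply/seteqP; split=> x; first by move=> [p [Cp|Dp]]; [left|right]; exists p.
  by move=> [[p Cp]|[p Dp]]; exists p; [left|right].
have cf := @seqfst_cts baire_space X; have sq := @sequential_seqprod.
pose e (w : seqprod baire_space X) : seqprod baire_space X := (evens w.1, w.2).
pose o (w : seqprod baire_space X) : seqprod baire_space X := (odds w.1, w.2).
have ce : continuous e.
  apply: pair_seqprod_cts => //; last exact: seqsnd_cts.
  exact: continuous_compose cf evens_cts.
have co : continuous o.
  apply: pair_seqprod_cts => //; last exact: seqsnd_cts.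
  exact: continuous_compose cf odds_cts.
exists (e @^-1` C `&` o @^-1` D).
  by have [] := PIU _ _ _ (PiS_preimage ce PC) (PiS_preimage co PD).
apply/seteqP; split=> x.
  by move=> [p [Cp Dp]]; split; [exists (evens p)|exists (odds p)].
move=> [[p Cp] [q Dq]]; exists (interleave p q); rewrite /e /o.
by split; rewrite /preimage/= ?evens_interleave ?odds_interleave.
Qed.

(** Complementation exchanges the two operations, so both closure properties climb the hierarchy
    together. *)
Lemma PiSIU n (X : topologicalType) (A B : set X) :
  PiS n A -> PiS n B -> PiS n (A `&` B) /\ PiS n (A `|` B).
Proof.
elim: n X A B => [|n IH] X A B PA PB; first by split; [exact: Pi02I|exact: Pi02U].
have [SI SU] := Sigma1SIU_of_PiS IH PA PB.
by rewrite /= setCI setCU.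
Qed.

Lemma Sigma1SI n (X : topologicalType) (A B : set X) :
  Sigma1S n A -> Sigma1S n B -> Sigma1S n (A `&` B).
Proof. by move=> SA SB; have [] := Sigma1SIU_of_PiS (@PiSIU n) SA SB. Qed.

(** The first entry of the witness names an index [n] with [x] in [U n] but not in [V n]. *)
Lemma Sigma02_Sigma11 (X : topologicalType) (U V : nat -> set X) :
  (forall n, open (U n)) -> (forall n, open (V n)) ->
  Sigma1S 0 (\bigcup_n (U n `\` V n)).
Proof.
move=> oU oV; pose T : topologicalType := seqprod baire_space X.
pose N n := [set w : T | w.1 0%N = n].
have oN n : open (N n).
  apply: sequential_seqprod => u w Nw /(cvg_cts (@seqfst_cts _ _)) /cvg_baire.
  by move=> /(_ 0%N); apply: filterS => i /=; rewrite /N /= => ->.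
have oS (O : set X) : open O -> open (snd @^-1` O : set T).
  by move/continuousP : (@seqsnd_cts baire_space X); exact.
(* With [n] the first entry, a pair is excluded if [x] is outside [U n] (flag [true]) or inside
   [V n] (flag [false], where nothing is subtracted). *)
pose F (i : nat * bool) : set T :=
  if i.2 then N i.1 else N i.1 `&` (snd @^-1` V i.1).
pose G (i : nat * bool) : set T := if i.2 then snd @^-1` U i.1 else set0.
exists (~` \bigcup_i (F i `\` G i)).
  apply: Pi02_countable => -[n []]; rewrite /F /G /=.
  - exact: oN.
  - by apply: openI; [exact: oN|exact: oS].
  - exact: oS.
  - exact: (@open0 T).
apply/seteqP; split=> x.
  move=> [p np]; exists (p 0%N) => //; split.
    by apply: contrapT => nU; apply: np; exists (p 0%N, true).
  by move=> Vx; apply: np; exists (p 0%N, false) => //; split=> //; case.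
move=> [n _ [Ux nVx]]; exists (fun=> n) => -[[m []] _]; rewrite /F /G /N /=.
  by move=> [/= <-].
by move=> [[/= <-]].
Qed.

(** At the bottom, the complement of a Pi^0_2 set is a countable union of differences, hence
    Sigma^1_1; higher up, induction applies to the complement of the set being projected. *)
Lemma Sigma1S_succ n (X : topologicalType) (A : set X) :
  Sigma1S n A -> Sigma1S n.+1 A.
Proof.
elim: n X A => [|n IH] X A [B PB <-]; exists B => //; last exact: (IH _ _ PB).
case: PB => U [V [oU oV ->]]; apply: eq_ind (Sigma02_Sigma11 oU oV) _ _.
by rewrite setCK.
Qed.

Definition projective (X : topologicalType) (A : set X) : Prop :=
  exists n, Sigma1S n A.

Lemma Sigma1S_leq m n (X : topologicalType) (A : set X) :
  (m <= n)%N -> Sigma1S m A -> Sigma1S n A.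
Proof.
move=> /subnK <-; elim: (n - m)%N => // k IH SA.
by rewrite addSn; apply: Sigma1S_succ; exact: IH.
Qed.

Lemma projectiveI (X : topologicalType) (A B : set X) :
  projective A -> projective B -> projective (A `&` B).
Proof.
move=> [m SA] [n SB]; exists (maxn m n).
apply: Sigma1SI; [apply: Sigma1S_leq SA|apply: Sigma1S_leq SB].
  exact: leq_maxl.
exact: leq_maxr.
Qed.

Lemma projectiveC (X : topologicalType) (A : set X) :
  projective A -> projective (~` A).
Proof. by move=> [n /Sigma1SC]; exists n.+1. Qed.

Lemma projective_pr (X : topologicalType) (A : set (seqprod baire_space X)) :
  projective A -> projective (pr A).
Proof. by move=> [n /Sigma1S_pr]; exists n. Qed.

Lemma projective_preimage (X Y : topologicalType) (f : X -> Y) (A : set Y) :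
  continuous f -> projective A -> projective (f @^-1` A).
Proof. by move=> cf [n /(Sigma1S_preimage cf)]; exists n. Qed.

Lemma projective_Pi02 (X : topologicalType) (A : set X) :
  Pi02 A -> projective A.
Proof. by move=> PA; exists 0%N; exact: (@PiS_Sigma1S 0%N). Qed.

(** * Admissible representations *)

Lemma subset_cts (Z : topologicalType) (D : set baire_space) (g : Z -> D) :
  continuous (fun z => set_val (g z) : baire_space) -> continuous g.
Proof.
move=> cg z A [_ [[U oU <-] Ugz UA]].
have := cg z _ (open_nbhs_nbhs (conj oU Ugz)).
by apply: (@filterS _ (nbhs z)) => y; exact: UA.
Qed.

Lemma set_val_cts (D : set baire_space) :
  continuous (set_val : D -> baire_space).
Proof. exact: initial_continuous. Qed.

Lemma baire_subset_clopen_seq (D : set baire_space) :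
  exists C : nat -> set D, clopen_base C.
Proof. exact: clopen_base_enum (baire_subset_clopen_base D). Qed.

Lemma baire_subset_sequential (D : set baire_space) : sequential D.
Proof.
by have [C [_ bC]] := baire_subset_clopen_seq D; exact: base_seq_sequential bC.
Qed.

(** The sequence with its limit is made into a continuous map [nu] on Baire space: a point whose
    first nonzero entry is at [n] goes to [u n], and the zero sequence goes to [x]. Admissibility
    lifts [nu]. *)
Lemma admissible_cvg_lift (X : topologicalType) (D : set baire_space)
    (delta : D -> X) (u : nat -> X) (x : X) :
  admissible delta -> u @ \oo --> x ->
  exists (v : nat -> D) (q : D),
    [/\ v @ \oo --> q, forall n, delta (v n) = u n & delta q = x].
Proof.
move=> [_ dadm] ux.
pose P (z : baire_space) n := z n != 0%N /\ forall k, (k < n)%N -> z k = 0%N.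
have Pfun z m n : P z m -> P z n -> m = n.
  move=> [zm mz] [zn nz]; case: (ltngtP m n) => // [/nz z0|/mz z0].
    by rewrite z0 in zm.
  by rewrite z0 in zn.
have Pex z k : z k != 0%N -> exists n, P z n.
  move=> zk; have e : exists n, z n != 0%N by exists k.
  exists (ex_minn e); case: ex_minnP => n zn nz; split=> // j jn.
  by apply/eqP; apply: contraLR jn => zj; rewrite -leqNgt; exact: nz.
pose nu (z : baire_space) : X :=
  if pselect (exists n, P z n) is left e then u (projT1 (cid e)) else x.
have nuP z n : P z n -> nu z = u n.
  move=> Pn; rewrite /nu; case: pselect => [e|]; last by case; exists n.
  by case: cid => m /= /Pfun -/(_ n Pn) ->.
have nu0 z : (forall n, ~ P z n) -> nu z = x.
  by move=> nP; rewrite /nu; case: pselect => // -[n Pn]; case: (nP n Pn).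
have cnu : continuous nu.
  apply: sequential_continuous sequential_baire _ => w z /cvg_baire wz A.
  have wz' m : \forall i \near \oo, forall k, (k < m)%N -> w i k = z k.
    elim: m => [|m IH]; first by apply: nearW.
    apply: filterS (filterI IH (wz m)) => i [wi wm] k.
    by rewrite ltnS leq_eqVlt => /orP[/eqP ->//|]; exact: wi.
  have [[n Pn]|nP] := pselect (exists n, P z n).
    rewrite (nuP _ _ Pn) => /nbhs_singleton Aun.
    apply: filterS (wz' n.+1) => i wi /=; rewrite (@nuP _ n) //.
    case: Pn => zn nz; split=> [|k kn]; first by rewrite wi.
    by rewrite (wi k (ltnW kn)); exact: nz.
  rewrite nu0; last by move=> n Pn; apply: nP; exists n.
  have z0 k : z k = 0%N.
    by apply/eqP; apply: contrapT => /negP zk; apply: nP; exact: Pex zk.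
  (* A point close to the zero sequence has its first nonzero entry, if any, at or beyond [N], where
     [u] stays in [A]. *)
  move=> Ax; have [N _ uN] := ux A Ax.
  apply: filterS (wz' N) => i wi /=.
  have [[n Pn]|nPi] := pselect (exists n, P (w i) n); last first.
    rewrite nu0; first exact: nbhs_singleton Ax.
    by move=> n Pn; apply: nPi; exists n.
  rewrite (nuP _ _ Pn); apply: uN => /=; rewrite leqNgt; apply/negP => nN.
  by case: Pn => + _; rewrite wi // z0.
have [C bC] := clopen_base_enum baire_clopen_base.
have [g [cg gE]] := dadm _ (clopen_base_clopen_based bC)
  (base_seq_second_countable (proj2 bC)) baire_kolmogorov nu cnu.
(* The points [e n], which [nu] sends to [u n], converge to the zero sequence, which [nu] sends to
   [x]. *)
pose e n : baire_space := fun k => (k == n : nat).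
have nuE z : nu z = delta (g z) by rewrite gE.
exists (g \o e), (g (fun=> 0%N)); split.
- apply: cvg_cts => //; apply/cvg_baire => k; exists k.+1 => // n /= kn.
  by rewrite /e; case: eqP kn => // ->; rewrite ltnn.
- move=> n /=; rewrite -nuE; apply: nuP; split=> [|k kn].
    by rewrite /e eqxx.
  by rewrite /e; case: eqP kn => // ->; rewrite ltnn.
- by rewrite -nuE; apply: nu0 => n [].
Qed.

(** Openness in [X] is tested on convergent sequences, and these lift to [D]. *)
Lemma admissible_quotient (X : topologicalType) (D : set baire_space)
    (delta : D -> X) :
  sequential X -> representation delta -> admissible delta ->
  quotient_map delta.
Proof.
move=> sX rd ad; split=> // U.
split; first by have /continuousP := proj1 ad; exact.
move=> oU; apply: sX => u x Ux ux.
have [v [q [vq vE qE]]] := admissible_cvg_lift ad ux.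
have : nbhs q (delta @^-1` U).
  by apply: open_nbhs_nbhs; split=> //; rewrite /preimage /= qE.
by move=> /vq; apply: (@filterS _ \oo) => n; rewrite /preimage /= vE.
Qed.

(** The representation itself serves as the quotient map, its domain being countably based. *)
Lemma QCB0P_intro (X : topologicalType) (D : set baire_space) (delta : D -> X) :
  kolmogorov_space X -> sequential X -> representation delta ->
  admissible delta -> projective (EQ delta) -> is_QCB0P X.
Proof.
move=> kX sX rd ad [n pd]; exists n.+1; split; last by exists D, delta.
split=> //; exists D; split; last by exists delta; exact: admissible_quotient.
have [C [_ bC]] := baire_subset_clopen_seq D.
exact: base_seq_second_countable bC.
Qed.

Lemma QCB0P_elim (X : topologicalType) :
  is_QCB0P X -> [/\ kolmogorov_space X, sequential X &
  exists (D : set baire_space) (delta : D -> X),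
    [/\ representation delta, admissible delta & projective (EQ delta)]].
Proof.
move=> [n [qX [D [delta [rd ad pd]]]]]; split; first by case: qX.
  exact: QCB0_sequential.
exists D, delta; split=> //.
(* Index 0 is Delta^1_1, from which the Sigma^1_1 half is kept. *)
by case: n pd => [[pd _]|n pd]; [exists 0%N|exists n].
Qed.

(** * The T0 axiom for products and exponentials *)

Lemma kolmogorov_separated (X : topologicalType) :
  (forall x y : X, x <> y -> exists (Y : topologicalType) (f : X -> Y),
    [/\ kolmogorov_space Y, continuous f & f x <> f y]) ->
  kolmogorov_space X.
Proof.
move=> sX x y /eqP/sX[Y [f [kY cf /eqP/kY[A Axy]]]].
exists (f @^-1` A); case: Axy => -[]; rewrite !inE => Ax Ay.
  by left; split=> //; exact: cf.
by right; split=> //; exact: cf.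
Qed.

Lemma seqprod_kolmogorov (X Y : topologicalType) :
  kolmogorov_space X -> kolmogorov_space Y -> kolmogorov_space (seqprod X Y).
Proof.
move=> kX kY; apply: kolmogorov_separated => -[x y] [x' y'] xy.
have [xx|/eqP xx] := eqVneq x x'.
  exists Y, snd; split=> //; first exact: seqsnd_cts.
  by move=> /= yy; apply: xy; rewrite xx yy.
by exists X, fst; split=> //; exact: seqfst_cts.
Qed.

Lemma seqexp_ev_cts (X Y : topologicalType) (x : X) :
  continuous (fun f : seqexp X Y => (f : continuousType X Y) x).
Proof.
have : continuous ((fun f => (f, x)) : seqexp X Y -> seqprod (seqexp X Y) X).
  apply: pair_seqprod_cts; first exact: sequential_sequentialization.
    exact: (@cts_fun _ _ (ctsid _)).
  exact: (@cst_continuous _ _ x).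
by move=> c; exact: (continuous_compose c (@seqeval_cts X Y)).
Qed.

Lemma seqexp_kolmogorov (X Y : topologicalType) :
  kolmogorov_space Y -> kolmogorov_space (seqexp X Y).
Proof.
move=> kY; apply: kolmogorov_separated => f g fg.
have [x fgx] : exists x, (f : continuousType X Y) x <> (g : continuousType X Y) x.
  apply: contrapT => nfg; apply: fg; apply/continuousEP => x.
  by apply: contrapT => fgx; apply: nfg; exists x.
exists Y, (fun h : seqexp X Y => (h : continuousType X Y) x).
by split=> //; exact: seqexp_ev_cts.
Qed.

(** * Coding continuous functions on Baire space *)

Lemma cvg_baire_prefix (u : nat -> baire_space) (p : baire_space) (m : nat) :
  u @ \oo --> p -> \forall n \near \oo, mkseq (u n) m = mkseq p m.
Proof.
move=> /cvg_baire up; elim: m => [|m IH]; first exact: nearW.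
apply: filterS (filterI IH (up m)) => n [ui um].
by rewrite /mkseq -addn1 iotaD !map_cat /= -!/(mkseq _ _) ui um.
Qed.

(* [p] is read as a table of answers: given the argument [q], the value at [n]
   is [k] if [k.+1] is the first nonzero entry of [p] met while consulting
   longer and longer prefixes of [q]. *)
Definition answers (p q : baire_space) (n k : nat) : Prop :=
  exists m, p (pickle (n, mkseq q m)) = k.+1 /\
    forall i, (i < m)%N -> p (pickle (n, mkseq q i)) = 0%N.

Definition computes (p q r : baire_space) : Prop := forall n, answers p q n (r n).

Lemma answers_inj p q n k k' : answers p q n k -> answers p q n k' -> k = k'.
Proof.
move=> [m [mk m0]] [m' [mk' m0']]; case: (ltngtP m m').
- by move=> /m0'; rewrite mk.
- by move=> /m0; rewrite mk'.
- by move=> mm; apply: succn_inj; rewrite -mk -mk' mm.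
Qed.

Lemma computes_inj p q r r' : computes p q r -> computes p q r' -> r = r'.
Proof. by move=> pr pr'; apply/funext => n; exact: answers_inj (pr n) (pr' n). Qed.

(** An answer depends on finitely many entries of [p] and on a finite prefix of [q]. *)
Lemma answers_near (u v : nat -> baire_space) (p q : baire_space) n k :
  u @ \oo --> p -> v @ \oo --> q -> answers p q n k ->
  \forall i \near \oo, answers (u i) (v i) n k.
Proof.
move=> /cvg_baire up vq [m [mk m0]].
have uv j : \forall i \near \oo, u i (pickle (n, mkseq (v i) j)) =
    p (pickle (n, mkseq q j)).
  by apply: filterS (filterI (cvg_baire_prefix j vq)
    (up (pickle (n, mkseq q j)))) => i [-> ->].
have uv0 : \forall i \near \oo, forall j, (j < m)%N ->
    u i (pickle (n, mkseq (v i) j)) = 0%N.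
  elim: m m0 {mk} => [|m IH] m0; first exact: nearW.
  have {}IH : \forall i \near \oo, forall j, (j < m)%N ->
      u i (pickle (n, mkseq (v i) j)) = 0%N.
    by apply: IH => j jm; apply: m0; exact: ltnW.
  apply: filterS (filterI IH (uv m)) => i [ui um] j.
  rewrite ltnS leq_eqVlt => /orP[/eqP ->|]; last exact: ui.
  by rewrite um m0.
by apply: filterS (filterI (uv m) uv0) => i [um u0]; exists m; rewrite um.
Qed.

Lemma computes_cvg (u v w : nat -> baire_space) (p q r : baire_space) :
  u @ \oo --> p -> v @ \oo --> q -> computes p q r ->
  (forall i, computes (u i) (v i) (w i)) -> w @ \oo --> r.
Proof.
move=> up vq pqr uvw; apply/cvg_baire => n.
apply: filterS (answers_near up vq (pqr n)) => i.
exact: answers_inj (uvw i n).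
Qed.

(** For each [n] the condition on the [n]-th value is open by [answers_near], so the relation is a
    countable intersection of open sets. *)
Lemma projective_computes :
  projective [set w : seqprod baire_space (seqprod baire_space baire_space) |
    computes w.1 w.2.1 w.2.2].
Proof.
pose T : topologicalType := seqprod baire_space (seqprod baire_space baire_space).
pose O n := [set w : T | answers w.1 w.2.1 n (w.2.2 n)].
rewrite (_ : mkset _ = \bigcap_n O n); last first.
  by apply/seteqP; split=> w cw n; [move=> _; exact: cw|exact: cw].
apply/projective_Pi02/Pi02_bigcap => n.
apply: sequential_seqprod => u w Ow uw.
have u1 := cvg_cts (@seqfst_cts _ _) uw.
have u2 := cvg_cts (@seqsnd_cts _ _) uw.
have u21 := cvg_cts (@seqfst_cts _ _) u2.
have /cvg_baire/(_ n) u22 := cvg_cts (@seqsnd_cts _ _) u2.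
by apply: filterS (filterI u22 (answers_near u1 u21 Ow)) => i [/= ui]; rewrite /O /= ui.
Qed.

Lemma near_clopen_iff (Z : topologicalType) (C : set Z) (u : nat -> Z) (z : Z) :
  open C -> closed C -> u @ \oo --> z -> \forall i \near \oo, C (u i) <-> C z.
Proof.
move=> oC cC uz; have [Cz|nCz] := pselect (C z).
  have := uz _ (open_nbhs_nbhs (conj oC Cz)).
  by apply: (@filterS _ \oo) => i Ci; split.
have oC' : open (~` C) by exact: closed_openC.
have := uz _ (open_nbhs_nbhs (conj oC' nCz)).
by apply: (@filterS _ \oo) => i nCi; split.
Qed.

(* Answer a query only once one of the finitely many clopen sets [C i], with [i]
   less than the length of the prefix, certifies the answer: this keeps [h]
   continuous. *)
Lemma computes_lift (Z : topologicalType) (C : nat -> set Z)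
    (D : set baire_space) (g : Z * D -> baire_space) :
  clopen_base C -> continuous g ->
  exists h : Z -> baire_space, continuous h /\
    forall z (q : D), computes (h z) (set_val q) (g (z, q)).
Proof.
move=> [cC [oC bC]] cg.
pose certifies i n s k :=
  forall z (q : D), C i z -> cylinder s (set_val q) -> g (z, q) n = k.
pose P z n s : set nat :=
  [set k | exists i, [/\ (i < size s)%N, C i z & certifies i n s k]].
(* The choice depends on the set alone, so equal sets give equal entries; 0 means no answer yet,
   whence the successor. *)
pose value (S : set nat) : nat :=
  if pselect (exists k, S k) is left e then (projT1 (cid e)).+1 else 0%N.
have value0 S k : S k -> value S != 0%N.
  by move=> Sk; rewrite /value; case: pselect => // -[]; exists k.
have valueS S k : value S = k.+1 -> S k.
  by rewrite /value; case: pselect => // e; case: cid => j Sj [<-].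
pose h (z : Z) : baire_space :=
  fun c => if unpickle c is Some (n, s) then value (P z n s) else 0%N.
have hE z n s : h z (pickle (n, s)) = value (P z n s) by rewrite /h pickleK.
exists h; split.
  apply: sequential_continuous (base_seq_sequential (conj oC bC)) _ => u z uz.
  apply/cvg_baire => c; rewrite /h /=; case: unpickle => [[n s]|]; last exact: nearW.
  (* [P z n s] depends on [z] only through the [C j] with [j < size s], and membership in each of
     these is eventually constant along [u]. *)
  have : \forall i \near \oo, forall j, (j < size s)%N -> C j (u i) <-> C j z.
    elim: (size s) => [|m IH]; first exact: nearW.
    apply: filterS (filterI IH (near_clopen_iff (oC m) (cC m) uz)) => i [ui um] j.
    by rewrite ltnS leq_eqVlt => /orP[/eqP ->//|]; exact: ui.
  apply: filterS => i ui; congr value; apply/seteqP.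
  by split=> k [j [js Cj jP]]; exists j; split=> //; exact/(ui j js).
move=> z q n.
have [m hm] : exists m, h z (pickle (n, mkseq (set_val q : baire_space) m)) != 0%N.
  have : nbhs (z, q) [set w | g w n = g (z, q) n].
    apply: (cg (z, q) [set r : baire_space | r n = g (z, q) n]).
    by apply/nbhs_baire; exists n.+1 => r; exact.
  move=> [[A B] /= [/bC[i [Ciz CA]] nB] ABg].
  have [s [sq sB]] := proj2 (proj2 (baire_subset_clopen_base D)) q B nB.
  (* A prefix of this length extends [s] and is longer than [i], as [P] demands. *)
  exists (maxn (size s) i.+1); rewrite hE; apply: (value0 _ (g (z, q) n)).
  exists i; split=> //; first by rewrite size_mkseq leq_maxr.
  move=> z' q' Ciz' mq'; apply: (ABg (z', q')); split=> /=; first exact: CA.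
  apply: sB => j js; rewrite -(sq j js) mq' ?size_mkseq ?leq_max ?js//.
  by rewrite nth_mkseq // leq_max js.
have e : exists m, h z (pickle (n, mkseq (set_val q : baire_space) m)) != 0%N.
  by exists m.
case: (ex_minnP e) => m' hm' min; exists m'; split; last first.
  by move=> i im; apply/eqP; apply: contraLR im => hi; rewrite -leqNgt; exact: min.
case hk : (h z _) hm' => [//|k] _; rewrite hE in hk.
have [i [_ Ciz cert]] := valueS _ _ hk.
by rewrite (cert z q) // => j; rewrite size_mkseq => jm; rewrite nth_mkseq.
Qed.

(** * Products and exponentials *)

Lemma cvg_infty_ge (phi : nat -> nat) :
  (forall n, (n <= phi n)%N) -> phi @ \oo --> \oo.
Proof.
move=> phin A [N _ NA]; exists N => // n /= Nn; apply: NA => /=.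
exact: leq_trans Nn (phin n).
Qed.

(* The sets [W m] below are sequentially open, hence open, and increase to the
   preimage of [O] under [f], so a compact set is inside one of them. *)
Lemma cvg_seqexp (X Y : topologicalType) (F : nat -> continuousType X Y)
    (f : continuousType X Y) :
  sequential X ->
  (forall phi : nat -> nat, phi @ \oo --> \oo ->
    forall (u : nat -> X) (x : X), u @ \oo --> x ->
      (fun j => F (phi j) (u j)) @ \oo --> f x) ->
  (F : nat -> seqexp X Y) @ \oo --> (f : seqexp X Y).
Proof.
move=> sX Ff; apply: (@cvg_sequentialization (compact_open_space X Y)).
pose toco (g : continuousType X Y) : {compact-open, X -> Y} := g : X -> Y.
suff tocoF : toco \o F @ \oo --> toco f.
  move=> A [_ [[U oU <-] Uf UA]].
  have := tocoF _ (open_nbhs_nbhs (conj oU Uf)).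
  by apply: (@filterS _ \oo) => n; exact: UA.
apply/compact_open_cvgP => K O cK oO fKO.
pose W m := [set x | O (f x) /\ forall n, (m <= n)%N -> O (F n x)].
have preim_open (g : continuousType X Y) (u : nat -> X) (x : X) :
    u @ \oo --> x -> O (g x) -> \forall j \near \oo, O (g (u j)).
  move=> ux Ogx; have cg := @cts_fun _ _ g.
  exact: (cvg_cts cg ux) (open_nbhs_nbhs (conj oO Ogx)).
have oW m : open (W m).
  apply: sX => u x [Ofx OFx] ux.
  (* Otherwise violating pairs of indices exist beyond every bound; reindexing [F] and [u] by their
     components contradicts [Ff]. *)
  have [M MP] : exists M, forall n j, (M <= n)%N -> (M <= j)%N -> O (F n (u j)).
    apply: contrapT => nM.
    have /choice[nj njP] M : exists nj : nat * nat,
        [/\ (M <= nj.1)%N, (M <= nj.2)%N & ~ O (F nj.1 (u nj.2))].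
      apply: contrapT => nnj; apply: nM; exists M => n j Mn Mj.
      by apply: contrapT => nO; apply: nnj; exists (n, j).
    have c1 : (fun M => (nj M).1) @ \oo --> \oo.
      by apply: cvg_infty_ge => M; case: (njP M).
    have c2 : (fun M => (nj M).2) @ \oo --> \oo.
      by apply: cvg_infty_ge => M; case: (njP M).
    have u2 : u \o (fun M => (nj M).2) @ \oo --> x by exact: cvg_comp c2 ux.
    have [N _ /(_ N (leqnn N))] := Ff _ c1 _ _ u2 _ (open_nbhs_nbhs (conj oO Ofx)).
    by case: (njP N).
  (* The indices below [M] are finitely many, and each [F n] is continuous. *)
  have lt_M : \forall j \near \oo, forall n, (n < M)%N -> (m <= n)%N -> O (F n (u j)).
    elim: M {MP} => [|M IH]; first exact: nearW.
    have FM : \forall j \near \oo, (m <= M)%N -> O (F M (u j)).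
      have [mM|mM] := leqP m M; last exact: nearW.
      by apply: filterS (preim_open (F M) _ _ ux (OFx M mM)) => j.
    apply: filterS (filterI IH FM) => j [uj uM] n.
    by rewrite ltnS leq_eqVlt => /orP[/eqP ->//|]; exact: uj.
  apply: filterS (filterI (filterI lt_M (preim_open f _ _ ux Ofx)) (nbhs_infty_ge M)).
  move=> j [[ltj Ofu] Mj]; split=> // n mn.
  by have [Mn|nM] := leqP M n; [exact: MP|exact: ltj].
move/compact_near_coveringP : cK => /(_ nat \oo W) cK.
have : \forall m \near \oo, K `<=` W m.
  apply: cK => x Kx; have Ofx : O (f x) by apply: fKO; exists x.
  (* Applied to the constant sequence at [x], the hypothesis places [x] in some [W m]. *)
  have := Ff id (fun _ h => h) (fun=> x) x (cvg_cst _) _ (open_nbhs_nbhs (conj oO Ofx)).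
  move=> [m _ mP]; have Wx : W m x by split=> // n mn; exact: mP.
  exists (W m, [set n | (m <= n)%N]).
    by split=> /=; [exact: open_nbhs_nbhs|exact: nbhs_infty_ge].
  move=> [y n] /= [[Ofy OFy] mn]; split=> // k nk; apply: OFy.
  exact: leq_trans mn nk.
apply: (@filterS _ \oo) => m KW _ [x Kx <-].
by have [_] := KW x Kx; exact.
Qed.

Lemma cvg_subset (D : set baire_space) (v : nat -> D) (q : D) :
  (fun n => set_val (v n) : baire_space) @ \oo --> (set_val q : baire_space) ->
  v @ \oo --> q.
Proof.
move=> vq A [_ [[U oU <-] Uq UA]].
have := vq _ (open_nbhs_nbhs (conj oU Uq)).
by apply: (@filterS _ \oo) => n; exact: UA.
Qed.

Lemma baire_subset_kolmogorov (D : set baire_space) : kolmogorov_space D.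
Proof.
apply: kolmogorov_separated => p q pq; exists baire_space, set_val.
split; [exact: baire_kolmogorov|exact: set_val_cts|].
by move=> /val_inj.
Qed.

Lemma prod_kolmogorov (X Y : topologicalType) :
  kolmogorov_space X -> kolmogorov_space Y -> kolmogorov_space (X * Y)%type.
Proof.
move=> kX kY; apply: kolmogorov_separated => -[x y] [x' y'] xy.
have [xx|/eqP xx] := eqVneq x x'.
  exists Y, snd; split=> //; first by move=> z; exact: cvg_snd.
  by move=> /= yy; apply: xy; rewrite xx yy.
by exists X, fst; split=> // z; exact: cvg_fst.
Qed.

(** * Representation of the product *)

Section product.
Variables (X Y : topologicalType) (DX DY : set baire_space).
Variables (dX : DX -> X) (dY : DY -> Y).
Hypotheses (rX : representation dX) (rY : representation dY).
Hypotheses (aX : admissible dX) (aY : admissible dY).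

Definition prod_dom : set baire_space :=
  [set p | DX (evens p) /\ DY (odds p)].

Definition prod_evens (d : prod_dom) : DX :=
  exist _ (evens (set_val d)) (mem_set (proj1 (set_valP d))).

Definition prod_odds (d : prod_dom) : DY :=
  exist _ (odds (set_val d)) (mem_set (proj2 (set_valP d))).

Definition prod_rep (d : prod_dom) : seqprod X Y :=
  (dX (prod_evens d), dY (prod_odds d)).

Lemma prod_dom_interleave (p : DX) (q : DY) :
  prod_dom (interleave (set_val p) (set_val q)).
Proof.
by rewrite /prod_dom /= evens_interleave odds_interleave; split; exact: set_valP.
Qed.

Definition prod_interleave (p : DX) (q : DY) : prod_dom :=
  exist _ (interleave (set_val p) (set_val q)) (mem_set (prod_dom_interleave p q)).

Lemma prod_rep_interleave p q : prod_rep (prod_interleave p q) = (dX p, dY q).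
Proof.
rewrite /prod_rep; congr (dX _, dY _); apply: val_inj => /=.
  exact: evens_interleave.
exact: odds_interleave.
Qed.

Lemma prod_rep_surj : representation prod_rep.
Proof.
move=> [x y] _; have [p _ <-] := rX (I : setT x); have [q _ <-] := rY (I : setT y).
by exists (prod_interleave p q) => //; exact: prod_rep_interleave.
Qed.

(** Both coordinates of a map into the product are lifted separately and the lifts interleaved. *)
Lemma prod_rep_admissible : admissible prod_rep.
Proof.
have sD := @baire_subset_sequential prod_dom.
have cv := @set_val_cts prod_dom.
split.
  apply: pair_seqprod_cts => //.
    apply: continuous_compose (proj1 aX); apply: subset_cts.
    exact: continuous_compose cv evens_cts.
  apply: continuous_compose (proj1 aY); apply: subset_cts.
  exact: continuous_compose cv odds_cts.
move=> Z cZ scZ kZ nu cnu.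
have c1 := continuous_compose cnu (@seqfst_cts X Y).
have c2 := continuous_compose cnu (@seqsnd_cts X Y).
have [g [cg gE]] := proj2 aX Z cZ scZ kZ _ c1.
have [h [ch hE]] := proj2 aY Z cZ scZ kZ _ c2.
exists (fun z => prod_interleave (g z) (h z)); split.
  apply: subset_cts; apply: interleave_cts; first exact: second_countable_sequential.
    exact: continuous_compose cg (@set_val_cts _).
  exact: continuous_compose ch (@set_val_cts _).
apply/funext => z /=; rewrite prod_rep_interleave.
have := congr1 (@^~ z) gE; have := congr1 (@^~ z) hE => /= <- <-.
by rewrite -surjective_pairing.
Qed.

Lemma prod_rep_EQ : projective (EQ dX) -> projective (EQ dY) ->
  projective (EQ prod_rep).
Proof.
move=> pX pY; pose T : topologicalType := seqprod baire_space baire_space.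
have both (f : baire_space -> baire_space) : continuous f ->
    continuous ((fun w : T => (f w.1, f w.2)) : T -> T).
  move=> cf; apply: pair_seqprod_cts; first exact: sequential_seqprod.
    exact: continuous_compose (@seqfst_cts _ _) cf.
  exact: continuous_compose (@seqsnd_cts _ _) cf.
rewrite (_ : EQ prod_rep = ((fun w : T => (evens w.1, evens w.2)) @^-1` EQ dX) `&`
    ((fun w : T => (odds w.1, odds w.2)) @^-1` EQ dY)).
  by apply: projectiveI; [exact: projective_preimage (both _ evens_cts) pX|
    exact: projective_preimage (both _ odds_cts) pY].
apply/seteqP; split=> -[a b].
  move=> [p [q [/(congr1 (fun z : X * Y => (z.1, z.2)))/= [pq1 pq2] [-> ->]]]].
  by split; [exists (prod_evens p), (prod_evens q)|exists (prod_odds p), (prod_odds q)].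
move=> [[p [p' [pp [ap bp]]]] [q [q' [qq [aq bq]]]]]; rewrite /= in ap bp aq bq.
have Da : prod_dom a by rewrite /prod_dom /= ap aq; split; exact: set_valP.
have Db : prod_dom b by rewrite /prod_dom /= bp bq; split; exact: set_valP.
exists (exist _ a (mem_set Da)), (exist _ b (mem_set Db)); split=> //.
rewrite /prod_rep.
have -> : prod_evens (exist _ a (mem_set Da)) = p by exact: val_inj.
have -> : prod_evens (exist _ b (mem_set Db)) = p' by exact: val_inj.
have -> : prod_odds (exist _ a (mem_set Da)) = q by exact: val_inj.
have -> : prod_odds (exist _ b (mem_set Db)) = q' by exact: val_inj.
by rewrite pp qq.
Qed.

End product.

Lemma QCB0P_seqprod (X Y : topologicalType) :
  is_QCB0P X -> is_QCB0P Y -> is_QCB0P (seqprod X Y).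
Proof.
move=> /QCB0P_elim[kX sX [DX [dX [rX aX pX]]]].
move=> /QCB0P_elim[kY sY [DY [dY [rY aY pY]]]].
apply: (@QCB0P_intro _ _ (@prod_rep _ _ _ _ dX dY)).
- exact: seqprod_kolmogorov.
- exact: sequential_seqprod.
- exact: prod_rep_surj.
- exact: prod_rep_admissible.
- exact: prod_rep_EQ.
Qed.

(** * Representation of the exponential *)

Section exponential.
Variables (X Y : topologicalType) (DX DY : set baire_space).
Variables (dX : DX -> X) (dY : DY -> Y).
Hypotheses (sX : sequential X).
Hypotheses (rX : representation dX) (rY : representation dY).
Hypotheses (aX : admissible dX) (aY : admissible dY).

Definition realizes (p : baire_space) (f : continuousType X Y) : Prop :=
  forall q : DX, exists r : DY,
    computes p (set_val q) (set_val r) /\ dY r = f (dX q).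

Lemma realizes_inj p f g : realizes p f -> realizes p g -> f = g.
Proof.
move=> pf pg; apply/continuousEP => x; have [q _ <-] := rX (I : setT x).
have [r [cr <-]] := pf q; have [r' [cr' <-]] := pg q.
by congr dY; apply: val_inj; exact: computes_inj cr cr'.
Qed.

(** The criterion [cvg_seqexp] is checked by lifting a convergent sequence of [X] to [DX], computing
    on the lift, and returning through [dY]. *)
Lemma realizes_cvg (p_ : nat -> baire_space) (p : baire_space)
    (f_ : nat -> continuousType X Y) (f : continuousType X Y) :
  p_ @ \oo --> p -> (forall n, realizes (p_ n) (f_ n)) -> realizes p f ->
  (f_ : nat -> seqexp X Y) @ \oo --> (f : seqexp X Y).
Proof.
move=> cp pf_ pf; apply: cvg_seqexp => // phi cphi u x ux.
have [v [q [vq vE qE]]] := admissible_cvg_lift aX ux.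
have [r [cr rE]] := pf q.
have /choice[w wP] n := pf_ (phi n) (v n).
have wr : w @ \oo --> r.
  apply: cvg_subset; apply: (computes_cvg _ _ cr (fun n => proj1 (wP n))).
    exact: cvg_comp cphi cp.
  exact: cvg_cts (@set_val_cts _) vq.
have := cvg_cts (proj1 aY) wr; rewrite rE qE.
rewrite (_ : dY \o w = fun j => f_ (phi j) (u j)) //.
by apply/funext => n /=; rewrite (proj2 (wP n)) vE.
Qed.

Definition exp_dom : set baire_space := [set p | exists f, realizes p f].

(** The choice is harmless: by [realizes_inj] a code realizes at most one map. *)
Definition exp_rep (d : exp_dom) : seqexp X Y := projT1 (cid (set_valP d)).

Lemma exp_repP (d : exp_dom) : realizes (set_val d) (exp_rep d).
Proof. by rewrite /exp_rep; case: cid. Qed.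

(** Serves twice: for admissibility, and with a constant [nu] for surjectivity. *)
Lemma exp_lift (Z : topologicalType) (nu : Z -> seqexp X Y) :
  clopen_based Z -> @second_countable Z -> kolmogorov_space Z -> continuous nu ->
  exists h : Z -> baire_space, continuous h /\ forall z, realizes (h z) (nu z).
Proof.
move=> cZ scZ kZ cnu; have [C bC] := clopen_base_exists cZ scZ.
(* The admissibility of [dY] will be applied to [Z * DX], which must therefore be zero-dimensional
   and countably based. *)
have [C' bC'] := clopen_base_enum (prod_clopen_base bC (baire_subset_clopen_base DX)).
pose G (w : Z * DX) : Y := (nu w.1 : continuousType X Y) (dX w.2).
have cG : continuous G.
  apply: (sequential_continuous (base_seq_sequential (proj2 bC'))) => u w uw.
  have u1 : fst \o u @ \oo --> w.1 by apply: cvg_comp uw _; exact: cvg_fst.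
  have u2 : snd \o u @ \oo --> w.2 by apply: cvg_comp uw _; exact: cvg_snd.
  pose v n : seqprod (seqexp X Y) X := (nu (u n).1, dX (u n).2).
  have : v @ \oo --> ((nu w.1, dX w.2) : seqprod (seqexp X Y) X).
    apply: cvg_seqprod; first exact: cvg_cts cnu u1.
    exact: cvg_cts (proj1 aX) u2.
  exact: cvg_cts (@seqeval_cts X Y).
have [g [cg gE]] := proj2 aY _ (clopen_base_clopen_based bC')
  (base_seq_second_countable (proj2 bC'))
  (prod_kolmogorov kZ (@baire_subset_kolmogorov DX)) _ cG.
have [h [ch hP]] := computes_lift bC (continuous_compose cg (@set_val_cts _)).
exists h; split=> // z q; exists (g (z, q)); split; first exact: hP.
by have := congr1 (@^~ (z, q)) gE.
Qed.

Lemma exp_rep_admissible : admissible exp_rep.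
Proof.
split.
  apply: (sequential_continuous (@baire_subset_sequential _)) => u d ud.
  have ud' := cvg_cts (@set_val_cts _) ud.
  exact: (realizes_cvg ud' (fun n => exp_repP (u n)) (exp_repP d)).
move=> Z cZ scZ kZ nu cnu; have [h [ch hP]] := exp_lift cZ scZ kZ cnu.
have Dh z : exp_dom (h z) by exists (nu z).
exists (fun z => exist _ (h z) (mem_set (Dh z))); split; first exact: subset_cts.
by apply/funext => z /=; exact: realizes_inj (hP z) (exp_repP (exist _ _ _)).
Qed.

Lemma exp_rep_surj : representation exp_rep.
Proof.
move=> f _; have [C bC] := clopen_base_enum baire_clopen_base.
have [h [_ hP]] := exp_lift (clopen_base_clopen_based bC)
  (base_seq_second_countable (proj2 bC)) baire_kolmogorov
  (@cst_continuous baire_space (seqexp X Y) f).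
have Dh : exp_dom (h (fun=> 0%N)) by exists f.
pose d : exp_dom := exist _ (h (fun=> 0%N)) (mem_set Dh).
by exists d => //; exact: realizes_inj (exp_repP d) (hP _).
Qed.

(** The right-hand side mentions no map. Conversely, it makes the computed values respect [dX], so
    they induce a map on [X], continuous because [dX] is a quotient map. *)
Lemma exp_rep_EQ_ex (p p' : baire_space) :
  EQ exp_rep (p, p') <->
  forall q q' : DX, dX q = dX q' -> exists r r' : DY,
    [/\ computes p (set_val q) (set_val r), computes p' (set_val q') (set_val r')
      & dY r = dY r'].
Proof.
split=> [[d [d' [dd [-> ->]]]] q q' qq|H].
  have [r [cr rE]] := exp_repP d q; have [r' [cr' rE']] := exp_repP d' q'.
  by exists r, r'; split=> //; rewrite rE rE' dd qq.
(* The diagonal case [q = q'] shows that both codes have a value at every [q]. *)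
have /choice[rr rrP] (q : DX) : exists rr : DY * DY,
    [/\ computes p (set_val q) (set_val rr.1),
        computes p' (set_val q) (set_val rr.2) & dY rr.1 = dY rr.2].
  by have [r [r' rP]] := H q q erefl; exists (r, r').
(* The value of [p] at [q] is compared with that of [p'] at [q'], then with that of [p] at [q']. *)
have rr_eq q q' : dX q = dX q' -> dY (rr q).1 = dY (rr q').1.
  move=> /H[r [r' [cr cr' rE]]].
  have [c1 _ _] := rrP q; have [_ c2 ->] := rrP q'.
  have -> : (rr q).1 = r by apply: val_inj; exact: computes_inj c1 cr.
  by have -> : (rr q').2 = r' by apply: val_inj; exact: computes_inj c2 cr'.
have /choice[sec secP] x : exists q, dX q = x.
  by have [q _ qE] := rX (I : setT x); exists q.
pose f (x : X) : Y := dY (rr (sec x)).1.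
have fE q : f (dX q) = dY (rr q).1 by apply: rr_eq; rewrite secP.
have cr : continuous (fun q => dY (rr q).1).
  apply: continuous_compose (proj1 aY).
  apply: (sequential_continuous (@baire_subset_sequential _)) => u q uq.
  apply: cvg_subset; apply: (@computes_cvg (fun=> p) _ _ p).
  - exact: cvg_cst.
  - exact: cvg_cts (@set_val_cts _) uq.
  - by case: (rrP q).
  - by move=> i; case: (rrP (u i)).
have cf : continuous f.
  apply/continuousP => U oU; apply/(proj2 (admissible_quotient sX rX aX)).
  rewrite (_ : _ @^-1` _ = (fun q => dY (rr q).1) @^-1` U).
    by move/continuousP : cr; exact.
  by apply/seteqP; split=> q; rewrite /preimage /= fE.
have pf : realizes p (mkcts cf).
  by move=> q; exists (rr q).1; split; [case: (rrP q)|rewrite -fE].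
have pf' : realizes p' (mkcts cf).
  move=> q; exists (rr q).2; case: (rrP q) => _ c E; split=> //.
  by rewrite -E -fE.
have Dp : exp_dom p by exists (mkcts cf).
have Dp' : exp_dom p' by exists (mkcts cf).
exists (exist _ p (mem_set Dp)), (exist _ p' (mem_set Dp')); split=> //.
by rewrite (realizes_inj (exp_repP (exist _ p (mem_set Dp))) pf)
  (realizes_inj (exp_repP (exist _ p' (mem_set Dp'))) pf').
Qed.

Lemma exp_rep_EQ : projective (EQ dX) -> projective (EQ dY) ->
  projective (EQ exp_rep).
Proof.
move=> pX pY.
pose B2 : topologicalType := seqprod baire_space baire_space.
pose B3 : topologicalType := seqprod baire_space B2.
pose B4 : topologicalType := seqprod baire_space B3.
have sB4 : sequential B4 by exact: sequential_seqprod.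
have sB3 : sequential B3 by exact: sequential_seqprod.
(* A point is [(t, (s, (p, p')))], where [t] interleaves the two values and [s] the two arguments.
   [EQ dY] also records that the values lie in [DY]. *)
pose S4 : set B4 := [set v |
  [/\ computes v.2.2.1 (evens v.2.1) (evens v.1),
      computes v.2.2.2 (odds v.2.1) (odds v.1) & EQ dY (evens v.1, odds v.1)]].
(* Counterexamples [s]: equivalent arguments without equivalent values. The universal quantifier
   becomes the complement of their projection. *)
pose S3 : set B3 := [set w | EQ dX (evens w.1, odds w.1)] `&` ~` pr S4.
have cpair (Z : topologicalType) (f g : Z -> baire_space) : sequential Z ->
    continuous f -> continuous g -> continuous ((fun z => (f z, g z)) : Z -> B2).
  exact: pair_seqprod_cts.
have c1 (Z : topologicalType) : continuous (fun w : seqprod baire_space Z => w.1).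
  exact: seqfst_cts.
have c2 (Z : topologicalType) : continuous (fun w : seqprod baire_space Z => w.2).
  exact: seqsnd_cts.
have pS4 : projective S4.
  pose f (v : B4) : B3 := (v.2.2.1, (evens v.2.1, evens v.1)).
  pose g (v : B4) : B3 := (v.2.2.2, (odds v.2.1, odds v.1)).
  pose k (v : B4) : B2 := (evens v.1, odds v.1).
  have cv21 : continuous (fun v : B4 => v.2.1).
    exact: continuous_compose (c2 B3) (c1 B2).
  have cv22 : continuous (fun v : B4 => v.2.2).
    exact: continuous_compose (c2 B3) (c2 B2).
  have cf : continuous f.
    apply: pair_seqprod_cts => //.
      exact: continuous_compose cv22 (c1 baire_space).
    apply: cpair => //; first exact: continuous_compose cv21 evens_cts.
    exact: continuous_compose (c1 B3) evens_cts.
  have cg : continuous g.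
    apply: pair_seqprod_cts => //.
      exact: continuous_compose cv22 (c2 baire_space).
    apply: cpair => //; first exact: continuous_compose cv21 odds_cts.
    exact: continuous_compose (c1 B3) odds_cts.
  have ck : continuous k.
    apply: cpair => //; first exact: continuous_compose (c1 B3) evens_cts.
    exact: continuous_compose (c1 B3) odds_cts.
  have := projectiveI (projective_preimage cf projective_computes)
    (projectiveI (projective_preimage cg projective_computes)
      (projective_preimage ck pY)).
  rewrite (_ : _ `&` _ = S4) //.
  by apply/seteqP; split=> v; [move=> [? [? ?]]|move=> [? ? ?]].
have pS3 : projective S3.
  apply: projectiveI; last exact/projectiveC/projective_pr.
  apply: (@projective_preimage B3 B2 (fun w => (evens w.1, odds w.1))) pX.
  apply: cpair => //; first exact: continuous_compose (c1 B2) evens_cts.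
  exact: continuous_compose (c1 B2) odds_cts.
rewrite (_ : EQ exp_rep = ~` pr S3); first exact/projectiveC/projective_pr.
apply/seteqP; split=> -[p p'].
  move=> /exp_rep_EQ_ex H [s [[q [q' [qq [sq1 sq2]]]] nS4]]; apply: nS4.
  have [r [r' [cr cr' rE]]] := H q q' qq.
  exists (interleave (set_val r) (set_val r')).
  rewrite /S4 /= in sq1 sq2 *; rewrite !(evens_interleave, odds_interleave) sq1 sq2.
  by split=> //; exists r, r'.
move=> nS3; apply/exp_rep_EQ_ex => q q' qq; apply: contrapT => nr.
apply: nS3; exists (interleave (set_val q) (set_val q')).
split.
  by rewrite /= evens_interleave odds_interleave; exists q, q'.
move=> [t []] /=; rewrite !(evens_interleave, odds_interleave).
move=> ct ct' [r [r' [rE [tr tr']]]]; apply: nr; exists r, r'.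
by rewrite -tr -tr'.
Qed.

End exponential.

Lemma QCB0P_seqexp (X Y : topologicalType) :
  is_QCB0P X -> is_QCB0P Y -> is_QCB0P (seqexp X Y).
Proof.
move=> /QCB0P_elim[kX sX [DX [dX [rX aX pX]]]].
move=> /QCB0P_elim[kY sY [DY [dY [rY aY pY]]]].
apply: (@QCB0P_intro _ _ (@exp_rep X Y _ _ dX dY)).
- exact: seqexp_kolmogorov.
- exact: sequential_sequentialization.
- exact: exp_rep_surj.
- exact: exp_rep_admissible.
- exact: exp_rep_EQ.
Qed.

(** * Cartesian closedness *)

(** Placing the terminal object inside Baire space lets it inherit the T0 axiom and
    sequentiality. *)
Definition point_space : topologicalType := [set (fun=> 0%N) : baire_space].

Definition point : point_space := exist _ (fun=> 0%N) (mem_set erefl).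

Lemma point_unique (x : point_space) : x = point.
Proof. by apply: val_inj; exact: (set_valP x). Qed.

Lemma QCB0P_point : is_QCB0P point_space.
Proof.
pose delta (_ : [set: baire_space]) : point_space := point.
apply: (@QCB0P_intro _ _ delta).
- exact: baire_subset_kolmogorov.
- exact: baire_subset_sequential.
- move=> x _; exists (exist _ (fun=> 0%N) (mem_set I)) => //.
  by rewrite (point_unique x).
- split=> [|Z _ _ _ nu _]; first exact: (@cst_continuous _ point_space point).
  exists (fun=> exist _ (fun=> 0%N) (mem_set I)); split.
    by apply: subset_cts; exact: cst_continuous.
  by apply/funext => z; exact: point_unique.
- apply: projective_Pi02; apply: open_Pi02.
  rewrite (_ : EQ delta = setT); first exact: openT.
  rewrite -subTset => -[p q] _.
  by exists (exist _ p (mem_set I)), (exist _ q (mem_set I)).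
Qed.

Lemma QCB0P_sequential (X : QCB0P) : sequential (space X).
Proof. by case: X => X /= /QCB0P_elim[]. Qed.

(** Pairing is continuous into the sequentialized product because every object of the category is
    sequential. *)
Lemma seqprod_is_product (X Y : QCB0P)
    (hXY : is_QCB0P (seqprod (space X) (space Y))) :
  @is_product QCB0P X Y (mkQCB0P hXY)
    (seqfst (space X) (space Y)) (seqsnd (space X) (space Y)).
Proof.
move=> Z f g.
have cfg := pair_seqprod_cts (@QCB0P_sequential Z) (@cts_fun _ _ f) (@cts_fun _ _ g).
pose h : continuousType (space Z) (seqprod (space X) (space Y)) := mkcts cfg.
exists h; split; first by split; exact/continuousEP.
move=> k [kf kg]; apply/continuousEP => z; rewrite [RHS]surjective_pairing.
congr pair.
  by have /continuousEP/(_ z) := kf.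
by have /continuousEP/(_ z) := kg.
Qed.

Lemma curry_cts (X Y Z : topologicalType) (f : continuousType (seqprod Z X) Y) :
  sequential X -> sequential Z ->
  exists h : continuousType Z (seqexp X Y),
    forall z x, (h z : continuousType X Y) x = f (z, x).
Proof.
move=> sX sZ.
have cz (z : Z) : continuous (fun x : X => f (z, x)).
  apply: (@continuous_compose _ _ _ (fun x => (z, x) : seqprod Z X) f).
    apply: pair_seqprod_cts => //; first exact: cst_continuous.
    exact: (@cts_fun _ _ (ctsid X)).
  exact: cts_fun.
pose h (z : Z) : seqexp X Y := mkcts (cz z).
have ch : continuous h.
  apply: sequential_continuous => // w z wz.
  apply: cvg_seqexp => // phi cphi u x ux.
  pose v j : seqprod Z X := (w (phi j), u j).
  have vzx : v @ \oo --> ((z, x) : seqprod Z X).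
    by apply: cvg_seqprod => //; exact: cvg_comp cphi wz.
  exact: cvg_cts (@cts_fun _ _ f) vzx.
by exists (mkcts ch).
Qed.

Lemma seqexp_is_exponential (X Y : QCB0P)
    (hE : is_QCB0P (seqexp (space X) (space Y)))
    (hEX : is_QCB0P (seqprod (seqexp (space X) (space Y)) (space X))) :
  @is_exponential QCB0P X Y (mkQCB0P hE) (mkQCB0P hEX)
    (seqfst (seqexp (space X) (space Y)) (space X))
    (seqsnd (seqexp (space X) (space Y)) (space X))
    (seqeval (space X) (space Y)).
Proof.
split; first exact: (@seqprod_is_product (mkQCB0P hE) X hEX).
move=> Z ZX q1 q2 pZX f.
have hZX : is_QCB0P (seqprod (space Z) (space X)).
  by apply: QCB0P_seqprod; exact: proj2_sig.
(* [ZX] is an arbitrary product, so [e] compares it with the concrete one. *)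
have [e [[e1 e2] _]] := pZX (mkQCB0P hZX)
  (seqfst (space Z) (space X)) (seqsnd (space Z) (space X)).
have sX := @QCB0P_sequential X; have sZ := @QCB0P_sequential Z.
have [h hP] := curry_cts (ctscomp f e) sX sZ.
have e1P z x : q1 (e (z, x)) = z by have /continuousEP/(_ (z, x)) := e1.
have e2P z x : q2 (e (z, x)) = x by have /continuousEP/(_ (z, x)) := e2.
(* The identity and [e] after the pairing of [q1] and [q2] both mediate for [q1] and [q2], hence
   they agree. *)
have eq12 w : e (q1 w, q2 w) = w.
  have sZX := @QCB0P_sequential ZX.
  have c12 := pair_seqprod_cts sZX (@cts_fun _ _ q1) (@cts_fun _ _ q2).
  have [k [_ ku]] := pZX ZX q1 q2.
  have k1 := ku (ctsid _) (conj (ctscompm1 _) (ctscompm1 _)).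
  pose c : continuousType (space ZX) (seqprod (space Z) (space X)) := mkcts c12.
  have k2 : k = ctscomp e c.
    by apply: ku; split; apply/continuousEP => v /=; [exact: e1P|exact: e2P].
  by have /continuousEP/(_ w) := etrans (esym k2) k1.
have ch := pair_seqprod_cts (@QCB0P_sequential ZX)
  (continuous_compose (@cts_fun _ _ q1) (@cts_fun _ _ h)) (@cts_fun _ _ q2).
pose k : continuousType (space ZX)
  (seqprod (seqexp (space X) (space Y)) (space X)) := mkcts ch.
exists h; split.
  exists k; split; [exact/continuousEP|exact/continuousEP|].
  apply/continuousEP => w /=.
  transitivity (f (e (q1 w, q2 w))); first exact: hP.
  by rewrite eq12.
(* The projections determine [k], so evaluating at [e (z, x)] fixes every value of [h' z]. *)
move=> h' [{}k [k1 k2 kf]]; apply/continuousEP => z; apply/continuousEP => x.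
rewrite hP /= -kf /=.
have kE : k (e (z, x)) = (h' z, x).
  rewrite [LHS]surjective_pairing; congr pair.
    by have /continuousEP/(_ (e (z, x))) /= := k1; rewrite e1P.
  by have /continuousEP/(_ (e (z, x))) /= := k2; rewrite e2P.
by rewrite kE.
Qed.

Theorem theorem8p1 :
  [/\ cartesian_closed QCB0P,
      forall X Y : topologicalType, is_QCB0P X -> is_QCB0P Y ->
        is_QCB0P (seqprod X Y) /\ is_QCB0P (seqexp X Y),
      forall (X Y : QCB0P) (hXY : is_QCB0P (seqprod (space X) (space Y))),
        @is_product QCB0P X Y (mkQCB0P hXY)
          (seqfst (space X) (space Y)) (seqsnd (space X) (space Y))
    & forall (X Y : QCB0P) (hE : is_QCB0P (seqexp (space X) (space Y)))
        (hEX : is_QCB0P (seqprod (seqexp (space X) (space Y)) (space X))),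
        @is_exponential QCB0P X Y (mkQCB0P hE) (mkQCB0P hEX)
          (seqfst (seqexp (space X) (space Y)) (space X))
          (seqsnd (seqexp (space X) (space Y)) (space X))
          (seqeval (space X) (space Y))].

Proof.
have objP (X : QCB0P) : is_QCB0P (space X) by exact: proj2_sig.
split; [split| |exact: seqprod_is_product|exact: seqexp_is_exponential].
- exists (mkQCB0P QCB0P_point) => X.
  pose c : continuousType (space X) point_space :=
    mkcts (@cst_continuous (space X) point_space point).
  exists c; split=> // g _.
  by apply/continuousEP => x; rewrite [RHS]point_unique.
- move=> X Y; have hXY := QCB0P_seqprod (objP X) (objP Y).
  exists (mkQCB0P hXY), (seqfst _ _), (seqsnd _ _).
  exact: seqprod_is_product.
- move=> X Y; have hE := QCB0P_seqexp (objP X) (objP Y).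
  have hEX := QCB0P_seqprod hE (objP X).
  exists (mkQCB0P hE), (mkQCB0P hEX), (seqfst _ _), (seqsnd _ _), (seqeval _ _).
  exact: seqexp_is_exponential.
- by move=> X Y qX qY; split; [exact: QCB0P_seqprod|exact: QCB0P_seqexp].
Qed.
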